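(* Let $\{\eta,\mathbf{q}\}$ be an entropy pair with entropy variable $v(u)=\eta'(u)$. Let $$p^e_h(v_h,u_h)=\int_{K^e}(v(u_h)-v_h)\left(\frac{\partial u_h}{\partial t}+\nabla\cdot\mathbf{f}(u_h)\right)\mathrm{d}\mathbf{x}-s_h^{\mathrm{LS},e}(v_h,u_h)$$ be the local entropy production term, and let $\nu^{\mathrm{EV},e}$ be an entropy viscosity coefficient which is bounded below (for each $e=1,\ldots,E_h$) by $$\nu^{\mathrm{EV},e,\min}:=\frac{\max\{0,p_h^e(v_h,u_h)\}}{\int_{K^e}(i_{h,1}^{e}v_h-i_{h,0}^{e}v_h)^2\,\mathrm{d}\mathbf{x}}.$$ Then the semi-discrete scheme $$\sum_{e=1}^{E_h}\left[\int_{K^e} w_h\left(\frac{\partial u_h}{\partial t}+\nabla\cdot \mathbf{f}(u_h)\right)\mathrm{d}\mathbf{x}+s_h^{\mathrm{LS},e}(w_h,u_h)+s_h^{\mathrm{EV},e}(w_h,v_h)\right]=0\qquad\forall w_h\in V_h,$$ with $$s_h^{\mathrm{EV},e}(w_h,v_h)=\nu^{\mathrm{EV},e}\int_{K^e}(i_{h,1}^{e}w_h-i_{h,0}^{e}w_h)(i_{h,1}^{e}v_h-i_{h,0}^{e}v_h)\,\mathrm{d}\mathbf{x},$$ satisfies the discrete entropy inequality $$\sum_{e=1}^{E_h}\int_{K^e}\left(\frac{\partial \eta(u_h)}{\partial t}+\nabla\cdot\mathbf{q}(u_h)\right)\mathrm{d}\mathbf{x}\le 0.$$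
   Context: The scalar conservation law is $\frac{\partial u}{\partial t}+\nabla\cdot\mathbf{f}(u)=0$ in $\mathbb{R}^d\times\mathbb{R}_+$, $d\in\{1,2,3\}$, with a possibly nonlinear flux function $\mathbf{f}$ and initial data with values in a convex set $\mathcal G\subset\mathbb{R}$. The set $\mathcal G$ is an invariant set of the initial value problem, i.e., the exact solution stays in $\mathcal G$ for all $t>0$. A convex function $\eta:\mathcal G\to\mathbb{R}$ is called an entropy, and $v(u)=\eta'(u)$ an entropy variable, if there is an entropy flux $\mathbf{q}:\mathcal G\to\mathbb{R}^d$ with $v(u)\mathbf{f}'(u)=\mathbf{q}'(u)$; $\{\eta,\mathbf{q}\}$ is then an entropy pair. Discretization: $\mathcal T_h=\{K^1,\ldots,K^{E_h}\}$ is a conforming mesh of a bounded domain in $\mathbb{R}^d$, with $\bar\Omega_h=\bigcup_{e=1}^{E_h}K^e$; the boundary conditions are periodic. For $p\in\mathbb{N}$, $V_h^e\in\{\mathbb{P}_p(K^e),\mathbb{Q}_p(K^e)\}$ and $V_h=\{v_h\in C(\bar\Omega_h): v_h|_{K^e}\in V_h^e,\ e=1,\ldots,E_h\}$. Let $\varphi_1,\ldots,\varphi_{N_h}$ be the Lagrange or Bernstein basis functions of $V_h$ associated with nodal points $\mathbf{x}_1,\ldots,\mathbf{x}_{N_h}\in\bar\Omega_h$, and let $\mathcal N^e$ be the set of indices of nodes belonging to $K^e$. The approximate solution is $u_h=\sum_{j=1}^{N_h} u_j\varphi_j\in V_h$ with time-dependent coefficients $u_j$. The function $v_h=\sum_{j=1}^{N_h}v_j\varphi_j\in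 V_h$ is an approximation to $v(u_h)$, defined either by $v_j=v(u_j)$, $j=1,\ldots,N_h$, or as the $L^2$ projection of $v(u_h)$ into $V_h$. $s_h^{\mathrm{LS},e}(w_h,u_h)$ is the element contribution of a linear high-order stabilization term with test function $w_h$ (for example of streamline upwind Petrov-Galerkin or variational multiscale type). The entropy viscosity coefficient satisfies $\nu^{\mathrm{EV},e}\ge 0$. For $w_h\in V_h$, $i_{h,1}^{e}w_h$ is the piecewise $\mathbb{P}_1/\mathbb{Q}_1$ Lagrange interpolant on $K^e$ of the nodal values $\{w_h(\mathbf{x}_j): j\in\mathcal N^e\}$ on the submesh of $K^e$ (subdivision into subcells) formed by the nodes $\{\mathbf{x}_j: j\in\mathcal N^e\}$, and $i_{h,0}^{e}w_h$ is the piecewise-constant function on this submesh whose value on each subcell is the average of $i_{h,1}^{e}w_h$ over that subcell. *)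

(* Defs.v *)
From HB Require Import structures.
From mathcomp Require Import all_boot all_order all_algebra.
From mathcomp Require Import all_classical all_reals all_analysis.

Set Implicit Arguments.
Unset Strict Implicit.
Unset Printing Implicit Defensive.

Import Order.TTheory GRing.Theory Num.Theory.
Import numFieldNormedType.Exports.

Local Open Scope classical_set_scope.
Local Open Scope ring_scope.

Section LebesgueTuple.
Context {R : realType}.

Definition tcons n (x : R * n.-tuple R) : n.+1.-tuple R := [tuple of x.1 :: x.2].

Lemma measurable_tcons n : measurable_fun [set: R * n.-tuple R] (@tcons n).
Proof. exact: measurable_cons. Qed.

Section step.
Variables (n : nat) (m : {sigma_finite_measure set (n.-tuple R) -> \bar R}).

Definition leb_step : set (n.+1.-tuple R) -> \bar R :=
  pushforward (@lebesgue_measure R \x m)%E (@tcons n).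

Let ls0 : leb_step set0 = 0%E.
Proof. by rewrite /leb_step /pushforward preimage_set0 measure0. Qed.

Let ls_ge0 A : (0 <= leb_step A)%E.
Proof. by rewrite /leb_step /pushforward measure_ge0. Qed.

Let ls_sigma_additive : semi_sigma_additive leb_step.
Proof.
move=> F mF tF mUF; rewrite /leb_step /pushforward preimage_bigcup.
apply: measure_semi_sigma_additive.
- by move=> k; rewrite -[X in measurable X]setTI; exact: measurable_tcons.
- apply/trivIsetP => /= i j _ _ ij; rewrite -preimage_setI.
  by move/trivIsetP : tF => /(_ _ _ _ _ ij) ->//; rewrite preimage_set0.
- by rewrite -preimage_bigcup -[X in measurable X]setTI; exact: measurable_tcons.
Qed.

HB.instance Definition _ := isMeasure.Build _ _ _ leb_step
  ls0 ls_ge0 ls_sigma_additive.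

Let ls_sigma_finite : sigma_finite setT leb_step.
Proof.
have /sigma_finiteP[F [F_T F_nd F_oo]] := sigma_finiteT (@lebesgue_measure R).
have /sigma_finiteP[H [H_T H_nd H_oo]] := sigma_finiteT m.
pose hd (t : n.+1.-tuple R) := tnth t ord0.
pose tl (t : n.+1.-tuple R) : n.-tuple R := [tuple of behead t].
exists (fun k => (hd @^-1` F k) `&` (tl @^-1` H k)).
  apply/esym; rewrite -subTset => t _.
  have : [set: R] (hd t) by []. rewrite F_T => -[i _ Fi].
  have : [set: n.-tuple R] (tl t) by []. rewrite H_T => -[j _ Hj].
  exists (maxn i j) => //; split => /=.
    by have /subsetPset := F_nd _ _ (leq_maxl i j); apply.
  by have /subsetPset := H_nd _ _ (leq_maxr i j); apply.
move=> k; have [mF Foo] := F_oo k; have [mH Hoo] := H_oo k; split.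
  apply: measurableI; rewrite -[X in measurable X]setTI.
    exact: (measurable_tnth ord0).
  exact: measurable_behead.
rewrite /leb_step /pushforward.
rewrite (_ : _ @^-1` _ = F k `*` H k).
  rewrite product_measure1E// lte_mul_pinfty//.
  by rewrite ge0_fin_numE.
rewrite predeqE => -[a b]; rewrite /hd /tl /tcons /=.
have -> : tnth [tuple of a :: b] ord0 = a by [].
by have -> : [tuple of behead [tuple of a :: b]] = b by exact: val_inj.
Qed.

HB.instance Definition _ :=
  @Measure_isSigmaFinite.Build _ _ _ leb_step ls_sigma_finite.
End step.

Fixpoint leb n : {sigma_finite_measure set (n.-tuple R) -> \bar R} :=
  match n return {sigma_finite_measure set (n.-tuple R) -> \bar R} with
  | 0 => \d_([tuple] : 0.-tuple R)
  | n.+1 => leb_step (leb n)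
  end.

End LebesgueTuple.

(** The measurable structure lives on tuples, the normed structure on row
    vectors: [pt] is the identification. *)
Definition pt (R : realType) d (x : d.-tuple R) : 'rV[R]_d := \row_i tnth x i.

Definition integral_rV (R : realType) d (A : set 'rV[R]_d) (g : 'rV[R]_d -> R) : R :=
  \int[leb d]_(x in @pt R d @^-1` A) g (pt x).

(** One-sided at an end point of [G] that belongs to [G]. *)
Definition has_deriv_in (R : realType) (G : set R) (g : R -> R) (a l : R) : Prop :=
  (fun y => (g y - g a) / (y - a)) @ within G a^' --> l.

Record entropy_pair (R : realType) d (G : set R) (f' : 'I_d -> R -> R)
    (eta v : R -> R) (q : 'I_d -> R -> R) : Prop := {
  entropy_convex : convex_function (G : set (convex_lmodType R^o)) (eta : R^o -> R^o);
  entropy_variable : forall a, G a -> has_deriv_in G eta a (v a);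
  entropy_flux : forall i a, G a -> has_deriv_in G (q i) a (v a * f' i a) }.

Definition divergence (R : realType) d (F : 'I_d -> 'rV[R]_d -> R) (x : 'rV[R]_d) : R :=
  \sum_i 'D_(delta_mx 0 i) (F i) x.

Definition balance (R : realType) d (g : R -> R) (F : 'I_d -> R -> R)
    (U : R -> 'rV[R]_d -> R) (t : R) (x : 'rV[R]_d) : R :=
  derive1 (fun s => g (U s x)) t + divergence (fun i y => F i (U t y)) x.

Inductive cell_shape := Simplex | Box.

Definition ref_cell (R : realType) d (s : cell_shape) : set 'rV[R]_d :=
  match s with
  | Simplex => [set x | (forall i, 0 <= x 0 i) /\ \sum_i x 0 i <= 1]
  | Box => [set x | forall i, 0 <= x 0 i <= 1]
  end.

(** Multi-indices with all entries at most [p]; on simplices the total degree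
    is at most [p] as well. *)
Definition admissible d p (s : cell_shape) (a : {ffun 'I_d -> 'I_p.+1}) : bool :=
  match s with
  | Simplex => (\sum_i a i <= p)%N
  | Box => true
  end.

(** P_p for simplices, Q_p for boxes. *)
Definition poly_space (R : realType) d (s : cell_shape) (p : nat) (g : 'rV[R]_d -> R) : Prop :=
  exists c : {ffun 'I_d -> 'I_p.+1} -> R, forall x,
    g x = \sum_(a | admissible s a) c a * \prod_i x 0 i ^+ a i.

Definition bernstein (R : realType) d (s : cell_shape) (p : nat)
    (a : {ffun 'I_d -> 'I_p.+1}) (x : 'rV[R]_d) : R :=
  match s with
  | Simplex =>
      (p`!)%:R / ((p - \sum_i a i)`! * \prod_i (a i)`!)%:R *
      (1 - \sum_i x 0 i) ^+ (p - \sum_i a i) * \prod_i x 0 i ^+ a i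
  | Box => \prod_i ('C(p, a i)%:R * x 0 i ^+ a i * (1 - x 0 i) ^+ (p - a i))
  end.

(** A convex extreme subset; for a polytope [A] these are its faces of all
    dimensions, including [set0] and [A]. *)
Definition face (R : realType) d (A F : set 'rV[R]_d) : Prop :=
  [/\ F `<=` A,
      convex_set (F : set (convex_lmodType 'rV[R]_d)) &
      forall x y (t : R), A x -> A y -> 0 < t < 1 ->
        F ((1 - t) *: x + t *: y) -> F x /\ F y].

(** A simplex is an affine, a quadrilateral or hexahedron a multilinear image
    of the reference cell. *)
Record cell (R : realType) d := Cell {
  cshape : cell_shape;
  geo : 'rV[R]_d -> 'rV[R]_d }.

Definition body (R : realType) d (K : cell R d) : set 'rV[R]_d :=
  geo K @` ref_cell (cshape K).

Definition vertices (R : realType) d (K : cell R d) : set 'rV[R]_d :=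
  geo K @` [set x | face (ref_cell (cshape K)) [set x]].

Record regular_cell (R : realType) d (K : cell R d) : Prop := {
  geo_poly : forall i, poly_space (cshape K) 1 (fun x => geo K x 0 i);
  geo_inj : {in ref_cell (cshape K) &, injective (geo K)};
  geo_jac : forall x, ref_cell (cshape K) x -> jacobian (geo K) x \in unitmx }.

(** Integrals over a cell are taken over its interior: its boundary is a null
    set, on which finite element functions need not be differentiable. *)
Definition cell_integral (R : realType) d (K : cell R d) (g : 'rV[R]_d -> R) : R :=
  integral_rV (body K)° g.

(** [K + z] and [L] meet in a common (possibly empty) proper face. *)
Definition conforming (R : realType) d (z : 'rV[R]_d) (K L : cell R d) : Prop :=
  exists FK FL : set 'rV[R]_d,
    [/\ face (ref_cell (cshape K)) FK /\ FK <> ref_cell (cshape K),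
        face (ref_cell (cshape L)) FL /\ FL <> ref_cell (cshape L),
        (fun x => x + z) @` body K `&` body L = (fun x => geo K x + z) @` FK &
        (fun x => x + z) @` body K `&` body L = geo L @` FL].

Definition lattice (R : realType) d (P : 'M[R]_d) : set 'rV[R]_d :=
  [set z | exists k : 'rV[int]_d, z = map_mx intr k *m P].

(** Periodic boundary conditions: the rows of [P] are the periods, and the
    closure of the domain [Om] is a fundamental domain of the lattice that they
    generate; conformity is required across the periodic boundary too. *)
Record periodic_mesh (R : realType) d (P : 'M[R]_d) (Om : set 'rV[R]_d)
    nE (K : 'I_nE -> cell R d) : Prop := {
  mesh_open : open Om;
  mesh_connected : connected Om;
  mesh_bounded : bounded_set Om;
  mesh_cells : closure Om = \bigcup_e body (K e);
  mesh_regular : forall e, regular_cell (K e);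
  mesh_periods : P \in unitmx;
  mesh_cover : forall x, exists2 z, lattice P z & closure Om (x + z);
  mesh_conforming : forall e e' z, lattice P z -> (e, z) <> (e', 0) ->
    conforming z (K e) (K e') }.

(** Continuous functions on the closure of the domain satisfying the periodic
    boundary conditions are represented by their periodic extensions. *)
Record fe_space (R : realType) d (P : 'M[R]_d) nE (K : 'I_nE -> cell R d)
    (p : nat) (w : 'rV[R]_d -> R) : Prop := {
  fe_periodic : forall x z, lattice P z -> w (x + z) = w x;
  fe_continuous : continuous w;
  fe_local : forall e, exists2 g, poly_space (cshape (K e)) p g &
    forall x, ref_cell (cshape (K e)) x -> w (geo (K e) x) = g x }.

Definition fe_fun (R : realType) d N (phi : 'I_N -> 'rV[R]_d -> R)
    (c : 'I_N -> R) (x : 'rV[R]_d) : R := \sum_j c j * phi j x.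

Record is_basis (R : realType) d (V : ('rV[R]_d -> R) -> Prop) N
    (phi : 'I_N -> 'rV[R]_d -> R) : Prop := {
  basis_in : forall j, V (phi j);
  basis_span : forall w, V w -> exists c, w =1 fe_fun phi c;
  basis_free : forall c, fe_fun phi c =1 cst 0 -> forall j, c j = 0 }.

Definition lagrange_basis (R : realType) d N (xn : 'I_N -> 'rV[R]_d)
    (phi : 'I_N -> 'rV[R]_d -> R) : Prop :=
  forall i j, phi j (xn i) = (i == j)%:R.

(** The local Bernstein polynomial with multi-index [a] belongs to the node
    [geo (a / p)]; the sum has more than one term only if a cell contains
    several periodic images of the same node. *)
Definition bernstein_basis (R : realType) d (P : 'M[R]_d) nE (K : 'I_nE -> cell R d)
    (p : nat) N (xn : 'I_N -> 'rV[R]_d) (phi : 'I_N -> 'rV[R]_d -> R) : Prop :=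
  forall e j x, ref_cell (cshape (K e)) x ->
    phi j (geo (K e) x) =
    \sum_(a : {ffun 'I_d -> 'I_p.+1} | admissible (cshape (K e)) a &&
        `[< lattice P (geo (K e) (\row_i ((a i)%:R / p%:R)) - xn j) >])
      bernstein (cshape (K e)) a x.

(** Nodal points lying in a cell, up to periodicity. *)
Definition cell_nodes (R : realType) d (P : 'M[R]_d) N (xn : 'I_N -> 'rV[R]_d)
    (K : cell R d) : set 'rV[R]_d :=
  [set x | body K x /\ exists j, lattice P (x - xn j)].

Record is_submesh (R : realType) d (K : cell R d) (nodes : set 'rV[R]_d)
    n (Sm : 'I_n -> cell R d) : Prop := {
  sub_shape : forall s, cshape (Sm s) = cshape K;
  sub_regular : forall s, regular_cell (Sm s);
  sub_cells : body K = \bigcup_s body (Sm s);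
  sub_conforming : forall s s', s <> s' -> conforming 0 (Sm s) (Sm s');
  sub_nodes : nodes = \bigcup_s vertices (Sm s) }.

(** [g] is the piecewise P_1/Q_1 Lagrange interpolant of [w]. *)
Definition is_interp1 (R : realType) d n (Sm : 'I_n -> cell R d)
    (w g : 'rV[R]_d -> R) : Prop :=
  forall s,
    (exists2 l, poly_space (cshape (Sm s)) 1 l &
       forall x, ref_cell (cshape (Sm s)) x -> g (geo (Sm s) x) = l x) /\
    (forall x, vertices (Sm s) x -> g x = w x).

(** Uniquely determined on the union of the subcells. *)
Definition interp1 (R : realType) d n (Sm : 'I_n -> cell R d)
    (w : 'rV[R]_d -> R) : 'rV[R]_d -> R :=
  xget (cst 0) [set g | is_interp1 Sm w g].

(** Zero on the boundaries of the subcells, which form a null set. *)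
Definition interp0 (R : realType) d n (Sm : 'I_n -> cell R d)
    (w : 'rV[R]_d -> R) (x : 'rV[R]_d) : R :=
  \sum_s \1_((body (Sm s))°) x *
    (cell_integral (Sm s) (interp1 Sm w) / cell_integral (Sm s) (cst 1)).

Definition fluct (R : realType) d n (Sm : 'I_n -> cell R d)
    (w : 'rV[R]_d -> R) (x : 'rV[R]_d) : R :=
  interp1 Sm w x - interp0 Sm w x.

Definition sEV (R : realType) d (K : cell R d) n (Sm : 'I_n -> cell R d)
    (nu : R) (w vh : 'rV[R]_d -> R) : R :=
  nu * cell_integral K (fun x => fluct Sm w x * fluct Sm vh x).

Definition entropy_production (R : realType) d (K : cell R d)
    (f : 'I_d -> R -> R) (v : R -> R)
    (sLS : ('rV[R]_d -> R) -> (R -> 'rV[R]_d -> R) -> R -> R)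
    (vh uh : R -> 'rV[R]_d -> R) (t : R) : R :=
  cell_integral K (fun x => (v (uh t x) - vh t x) * balance id f uh t x)
  - sLS (vh t) uh t.

(** The quotient is taken in the extended reals: a / 0 = +oo for a > 0, and
    0 / 0 = 0. *)
Definition nu_min (R : realType) d (K : cell R d) n (Sm : 'I_n -> cell R d)
    (f : 'I_d -> R -> R) (v : R -> R)
    (sLS : ('rV[R]_d -> R) -> (R -> 'rV[R]_d -> R) -> R -> R)
    (vh uh : R -> 'rV[R]_d -> R) (t : R) : \bar R :=
  ((Num.max 0 (entropy_production K f v sLS vh uh t))%:E /
   (cell_integral K (fun x => fluct Sm (vh t) x ^+ 2))%:E)%E.

Definition is_L2_projection (R : realType) d (V : ('rV[R]_d -> R) -> Prop)
    nE (K : 'I_nE -> cell R d) (g vh : 'rV[R]_d -> R) : Prop :=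
  V vh /\ forall w, V w ->
    \sum_e cell_integral (K e) (fun x => w x * (vh x - g x)) = 0.

(* Main.v *)
Require Import Defs.
From mathcomp Require Import all_boot all_order all_algebra.
From mathcomp Require Import all_classical all_reals all_analysis.
From mathcomp Require Import measurable_realfun ring lra.

Set Implicit Arguments.
Unset Strict Implicit.
Unset Printing Implicit Defensive.

Import Order.TTheory GRing.Theory Num.Theory.
Import numFieldNormedType.Exports.

Local Open Scope classical_set_scope.
Local Open Scope ring_scope.

(** Testing the scheme with [w_h = v_h] gives, with [r] the residual
    [d/dt u_h + div f(u_h)],
    [[ sum_e (int_(K^e) v_h r + s_LS(v_h, u_h) + s_EV(v_h, v_h)) = 0. ]]
    By the chain rule and the compatibility condition [q' = v f'], the
    integrand of the entropy inequality is [v(u_h) r = (v(u_h) - v_h) r + v_h r].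
    Hence the left-hand side of the inequality equals
    [[ sum_e (p_e - nu_e int_(K^e) (i_1 v_h - i_0 v_h)^2), ]]
    and every term of it is nonpositive, because the lower bound on [nu_e] says
    [p_e <= nu_e int_(K^e) (i_1 v_h - i_0 v_h)^2]; when the integral vanishes, the
    extended-real quotient is finite only if [p_e <= 0]
    ([le_of_quotient_bound]).

    The analysis lies in justifying the pointwise chain rule on the interior of
    a cell and the splitting of the integral.

    - Differentiability ([cell_partial]). On a cell a finite element function is
      [g o geo^-1], with polynomials [g] and [geo]. A polynomial factors as
      [g y - g x = sum_k (y_k - x_k) m_k(x, y)] with continuous [m_k] (Hadamard's
      lemma). Applied to the coordinates of [geo], whose factors form a matrix
      [J(x, y)] with [J(x, x)] the Jacobian, this inverts difference quotients by
      the adjugate of [J] (Cramer's rule). Since [geo^-1] is continuous, by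
      compactness of the reference cell, the difference quotients converge, to
      [sum_k adj(J)_ik m_k / det J] at [x = y = geo^-1(.)]. These partial
      derivatives are continuous, and bounded because the formula is continuous
      on the whole reference cell.
    - Chain rule ([is_derive_comp_within]). The derivatives of [eta] and [q] are
      taken within [G] only, which suffices as [u_h] stays in [G].
    - Integrability ([bounded_measurable_entropy_variable]). The entropy variable
      is nondecreasing on [G], since [eta] is convex
      ([convex_derive_nondecreasing]). So [v(u_h)] is measurable, and on a compact
      cell it lies between its values at the extrema of [u_h]. The remaining
      factors are bounded and continuous, and cells have finite measure. *)

(** * Derivatives within a set and convexity *)

Lemma cvg_line (R : realType) (V : normedModType R) (x v : V) :
  h *: v + x @[h --> (0 : R)^'] --> x.
Proof.
rewrite -[X in _ --> X]add0r -[X in _ --> X + _](scale0r v).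
apply: cvgD; last exact: cvg_cst.
by apply: cvgZr_tmp => //; exact: nbhs_dnbhs.
Qed.

(** The chain rule, with the derivative of the outer function taken within a set
    that the inner function does not leave. One statement serves for the time
    derivative and for the partial derivatives in space. *)
Lemma is_derive_comp_within (R : realType) (V : normedModType R) (G : set R)
    (g : R -> R) (l : R) (phi : V -> R) (x v : V) (dphi : R) :
  has_deriv_in G g (phi x) l ->
  (\forall y \near x, G (phi y)) ->
  is_derive x v phi dphi ->
  is_derive x v (fun y => g (phi y)) (l * dphi).
Proof.
move=> gl Gphi [phix phixE].
(* The difference quotient extended by [l] at [phi x]: the inner function may
   return to the value [phi x] arbitrarily close to [x]. *)
pose psi y := if y == phi x then l else (g y - g (phi x)) / (y - phi x).
have psiE y : g y - g (phi x) = psi y * (y - phi x).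
  rewrite /psi; case: eqVneq => [->|yx]; first by rewrite !subrr mulr0.
  by rewrite divfK// subr_eq0.
have psil : psi @ within G (nbhs (phi x)) --> l.
  move=> A Al; have /= := gl A Al; rewrite /nbhs/= /within/= => gA.
  rewrite near_simpl; near=> y => Gy; rewrite /psi; case: eqVneq => [_|yx].
    exact: nbhs_singleton.
  by move: yx Gy; near: y; exact: gA.
have phil : h^-1 * (phi (h *: v + x) - phi x) @[h --> 0^'] --> dphi.
  by rewrite -phixE; exact: phix.
have shx := @cvg_line _ _ x v.
have phic : phi (h *: v + x) @[h --> 0^'] --> phi x.
  have : phi x + h * (h^-1 * (phi (h *: v + x) - phi x)) @[h --> 0^'] -->
      phi x + 0 * dphi.
    apply: cvgD; first exact: cvg_cst.
    by apply: cvgM phil; exact: nbhs_dnbhs.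
  rewrite mul0r addr0; apply: cvg_trans; apply: near_eq_cvg; near=> h.
  by rewrite mulVKf ?subrKC//; near: h; exact: nbhs_dnbhs_neq.
have cvg : h^-1 * (g (phi (h *: v + x)) - g (phi x)) @[h --> 0^'] --> l * dphi.
  under eq_cvg do rewrite psiE mulrCA.
  apply: cvgM => // A /psil; rewrite /nbhs/= => Apsi.
  have /phic := Apsi; rewrite /nbhs/= => Aphi.
  near=> h; apply: (near Aphi h) => //.
  near: h; exact: (shx _ Gphi).
split; last exact/cvg_lim.
by apply/cvg_ex; exists (l * dphi).
Unshelve. all: by end_near. Qed.

(** A convex function lies above its tangents: on the segment from [a] to [b] its
    slope at [a] is at most that of the chord, and the segment stays in [G]. *)
Lemma convex_tangent (R : realType) (G : set R) (g : R -> R) (a b l : R) :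
  convex_set (G : set (convex_lmodType R^o)) ->
  convex_function (G : set (convex_lmodType R^o)) (g : R^o -> R^o) ->
  has_deriv_in G g a l -> G a -> G b -> l * (b - a) <= g b - g a.
Proof.
move=> cG cg gl Ga Gb.
have [->|ab] := eqVneq a b; first by rewrite !subrr mulr0.
pose y t := a + t * (b - a).
have sl t : 0 < t < 1 -> [/\ G (y t), y t != a &
    (g (y t) - g a) / (y t - a) * (b - a) <= g b - g a].
  move=> /andP[t0 t1].
  have t01 : Itv.spec (@Itv.num_sem R)
      (Itv.Real (Interval (BLeft (0:int)) (BRight (1:int)))) t.
    by rewrite /= /Itv.num_sem/= num_real/= in_itv/= !ltW.
  pose T : {i01 R} := Itv.mk t01.
  have yE : y t = T%:num * b + (1 - T%:num) * a by rewrite /y/=; ring.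
  have Gy : G (y t).
    by have := cG b a T; rewrite !inE yE => /(_ Gb Ga).
  have gy : g (y t) <= T%:num * g b + (1 - T%:num) * g a.
    by have := cg T b a; rewrite !inE yE => /(_ Gb Ga).
  have ba0 : b - a != 0 by rewrite subr_eq0 eq_sym.
  have yta : y t - a = t * (b - a) by rewrite /y; ring.
  split=> //; first by rewrite -subr_eq0 yta mulf_neq0// gt_eqF.
  rewrite yta invfM -!mulrA mulVf// mulr1 ler_pdivrMr//.
  by move: gy => /=; lra.
have ya : y t @[t --> 0^'+] --> a.
  rewrite -[X in _ --> X]addr0 -[X in _ --> a + X](mul0r (b - a)).
  apply: cvgD; first exact: cvg_cst.
  by apply: cvgMr_tmp; exact: cvg_at_right_filter.
have lim : (g (y t) - g a) / (y t - a) * (b - a) @[t --> 0^'+] --> l * (b - a).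
  apply: cvgMr_tmp => A /gl; rewrite /nbhs/= => Al.
  have /ya := Al; rewrite /nbhs/= => Ay.
  near=> t; have [|Gy yta _] := sl t.
    by apply/andP; split; [near: t; exact: nbhs_right_gt|
      near: t; exact: nbhs_right_lt].
  by apply: (near Ay t).
apply: (ler_cvg_to lim (cvg_cst (g b - g a))).
near=> t; have [|//] := sl t.
by apply/andP; split; [near: t; exact: nbhs_right_gt|
  near: t; exact: nbhs_right_lt].
Unshelve. all: by end_near. Qed.

(** Compare the slope of the chord from [a] to [b] with the tangents at both of its
    ends. *)
Lemma convex_derive_nondecreasing (R : realType) (G : set R) (g v : R -> R) :
  convex_set (G : set (convex_lmodType R^o)) ->
  convex_function (G : set (convex_lmodType R^o)) (g : R^o -> R^o) ->
  (forall a, G a -> has_deriv_in G g a (v a)) ->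
  {in G &, {homo v : a b / a <= b}}.
Proof.
move=> cG cg gv a b /set_mem Ga /set_mem Gb.
rewrite le_eqVlt => /predU1P[->//|ab].
have va := convex_tangent cG cg (gv _ Ga) Ga Gb.
have vb := convex_tangent cG cg (gv _ Gb) Gb Ga.
by rewrite -(ler_pM2r (_ : 0 < b - a)) ?subr_gt0//; lra.
Qed.

(** * Row vectors and the measure on tuples *)

Definition cube (R : realType) n (M : R) : set (n.-tuple R) :=
  [set x | forall i, `|tnth x i| <= M].

Lemma measurable_cube (R : realType) n (M : R) : measurable (@cube R n M).
Proof.
rewrite (_ : cube M =
    \bigcap_(i in [set: 'I_n]) ((@tnth n R)^~ i @^-1` [set r | `|r| <= M])).
  apply: fin_bigcap_measurable => // i _.
  rewrite -[X in measurable X]setTI; apply: measurable_tnth => //.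
  rewrite (_ : [set _ | _] = `[- M, M]%classic); first exact: measurable_itv.
  by apply/seteqP; split=> r/=; rewrite in_itv/= ler_norml.
by apply/seteqP; split=> x /= Mx i => [_|]; apply: Mx.
Qed.

Lemma leb_cube_lty (R : realType) n (M : R) : (leb n (@cube R n M) < +oo)%E.
Proof.
elim: n => [|n IHn] /=.
  by rewrite diracE; case: (_ \in _); rewrite ltry.
rewrite /leb_step /pushforward.
rewrite (_ : _ @^-1` _ = [set r | `|r| <= M] `*` cube M); last first.
  apply/seteqP; split=> -[a x] /=.
    move=> Mx; split=> [|i]; first exact: (Mx ord0).
    have := Mx (lift ord0 i).
    by rewrite !(tnth_nth 0).
  move=> [Ma Mx] i; case: (unliftP ord0 i) => [j ->|->//].
  by have := Mx j; rewrite !(tnth_nth 0).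
have -> : [set r | `|r| <= M] = `[- M, M]%classic.
  by apply/seteqP; split=> r/=; rewrite in_itv/= ler_norml.
rewrite product_measure1E//; last exact: measurable_cube.
rewrite lte_mul_pinfty//.
suff : lebesgue_measure `[- M, M]%classic \is a fin_num by [].
by rewrite lebesgue_measure_itv/=; case: ifP => // _; rewrite -EFinB.
Qed.

(** The sigma-algebra of tuples is generated by the coordinates, so it contains
    boxes; an open set is the union of the countably many boxes with rational
    centres and radii [1 / (n + 1)] that it contains. *)
Lemma measurable_preimage_pt (R : realType) d (U : set 'rV[R]_d) :
  open U -> measurable (@pt R d @^-1` U).
Proof.
move=> oU.
pose B (c : 'rV[rat]_d * nat) : set 'rV[R]_d :=
  [set x | forall i, `|x 0 i - ratr (c.1 0 i)| < c.2.+1%:R^-1].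
have -> : @pt R d @^-1` U =
    \bigcup_c (if `[< B c `<=` U >] then @pt R d @^-1` (B c) else set0).
  apply/seteqP; split=> [x Ux|x [c _]]; last by case: asboolP => // cU /cU.
  have := oU; rewrite openE => /(_ _ Ux) /nbhs_ballP[e /= e0 eU].
  have [n ne] : exists n, n.+1%:R^-1 < e / 2.
    have [n _ nP] := @near_infty_natSinv_lt R (PosNum (divr_gt0 e0 (ltr0n R 2))).
    by exists n; exact: nP (leqnn n).
  have n0 : (0 : R) < n.+1%:R^-1 by [].
  have /choice[c cx] : forall i, exists q : rat, `|(pt x) 0 i - ratr q| < n.+1%:R^-1.
    move=> i; have : pt x 0 i - n.+1%:R^-1 < pt x 0 i by rewrite ltrBlDr ltrDl.
    move=> /rat_in_itvoo[q]; rewrite in_itv/= => /andP[q1 q2]; exists q.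
    by rewrite ltr_distl -ltrBlDr q1 andbT (lt_trans _ q2)// ltrBlDr ltrDl.
  have Bx : B (\row_i c i, n) (pt x).
    by move=> i; rewrite /= [(\row_ _ _) _ _]mxE; exact: cx.
  exists (\row_i c i, n) => //; case: asboolP => // -[]; apply: subset_trans eU.
  move=> y yB; split=> // i j; rewrite !ord1.
  apply: le_lt_trans (ler_distD (ratr (c j)) _ _) _.
  rewrite (splitr e) ltrD// (lt_trans _ ne)//.
  by rewrite distrC; have := yB j; rewrite /= [(\row_ _ _) _ _]mxE.
apply: countable_bigcupT_measurable => [|c]; first exact: countableP.
case: ifP => // _.
rewrite (_ : _ @^-1` _ = \bigcap_(i in [set: 'I_d]) ((@tnth d R)^~ i @^-1`
    [set r | `|r - ratr (c.1 0 i)| < c.2.+1%:R^-1])).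
  apply: fin_bigcap_measurable => // i _.
  rewrite -[X in measurable X]setTI; apply: measurable_tnth => //.
  rewrite (_ : [set _ | _] = `](ratr (c.1 0 i) - c.2.+1%:R^-1),
    (ratr (c.1 0 i) + c.2.+1%:R^-1)[%classic); first exact: measurable_itv.
  by apply/seteqP; split=> r/=; rewrite in_itv/= ltr_distl.
by apply/seteqP; split=> x /= Bx i => [_|]; have := Bx i; rewrite mxE; apply.
Qed.

Lemma measurable_fun_pt (R : realType) d (U : set 'rV[R]_d) (g : 'rV[R]_d -> R) :
  open U -> (forall x, U x -> {for x, continuous g}) -> 
  measurable_fun (@pt R d @^-1` U) (g \o @pt R d).
Proof.
move=> oU cg mD; apply: (measurability _ (RGenOInfty.measurableE R)) => //.
move=> /= _ [_ [r ->] <-].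
rewrite (_ : _ `&` _ = @pt R d @^-1` (U `&` [set x | r < g x])); last first.
  by apply/seteqP; split=> x /=; rewrite in_itv/= andbT.
apply: measurable_preimage_pt; rewrite openE => x [Ux rx].
by apply: filterI; [exact: open_nbhs_nbhs|exact: (cg x Ux _ (lt_nbhsr rx))].
Qed.

Lemma integrable_pt (R : realType) d (U : set 'rV[R]_d) (g : 'rV[R]_d -> R) :
  open U -> bounded_set U -> measurable_fun (@pt R d @^-1` U) (g \o @pt R d) ->
  [bounded g x | x in U] ->
  (@leb R d).-integrable (@pt R d @^-1` U) (EFin \o (g \o @pt R d)).
Proof.
move=> oU bU mg bg.
apply: measurable_bounded_integrable => //.
- exact: measurable_preimage_pt.
- have [M [_ UM]] := bU.
  apply: le_lt_trans (leb_cube_lty d (M + 1)).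
  apply: le_measure; rewrite ?inE//.
  + exact: measurable_preimage_pt.
  + exact: measurable_cube.
  move=> x Ux i; have /= := UM (M + 1) _ _ Ux; rewrite ltrDl ltr01 => /(_ isT).
  apply: le_trans; rewrite [leRHS]/Num.Def.normr/= mx_normrE.
  by have := le_bigmax 0 (fun k : 'I_1 * 'I_d => `|pt x k.1 k.2|) (0, i); rewrite /= mxE.
- by have [M [Mr gM]] := bg; exists M; split=> // N MN x Ux; exact: gM MN _ Ux.
Qed.

(** * Hadamard factorization of polynomials *)

(** Unlike a derivative, the factors [m] of a difference give exact identities for
    finite increments, which can be solved for the increment by linear algebra. *)
Definition hadamard (R : realType) d (g : 'rV[R]_d -> R)
    (m : 'I_d -> 'rV[R]_d * 'rV[R]_d -> R) : Prop :=
  (forall k, continuous (m k)) /\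
  forall x y, g y - g x = \sum_k (y 0 k - x 0 k) * m k (x, y).

Definition factorable (R : realType) d (g : 'rV[R]_d -> R) : Prop :=
  (forall x, differentiable g x) /\ exists m, hadamard g m.

Section factorable.
Context {R : realType} {d : nat}.
Implicit Types g h : 'rV[R]_d -> R.

Lemma factorable_cst (c : R) : factorable (fun _ : 'rV[R]_d => c).
Proof.
split=> [x|]; first exact: differentiable_cst.
exists (fun _ _ => 0); split=> [k x|x y]; first exact: cvg_cst.
by rewrite subrr big1// => k _; rewrite mulr0.
Qed.

Lemma factorable_coord (i : 'I_d) : factorable (fun x : 'rV[R]_d => x 0 i).
Proof.
split=> [x|]; first exact: differentiable_coord.
exists (fun k _ => (k == i)%:R); split=> [k x|x y]; first exact: cvg_cst.
by rewrite (bigD1 i)//= eqxx mulr1 big1 ?addr0// => k /negbTE->; rewrite mulr0.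
Qed.

Lemma factorableD g h : factorable g -> factorable h ->
  factorable (fun x => g x + h x).
Proof.
move=> [dg [m [cm gm]]] [dh [n [cn hn]]]; split=> [x|].
  exact: differentiableD.
exists (fun k z => m k z + n k z); split=> [k x|x y].
  by apply: cvgD; [exact: cm|exact: cn].
rewrite opprD addrACA gm hn -big_split/=.
by apply: eq_bigr => k _; rewrite mulrDr.
Qed.

Lemma factorableM g h : factorable g -> factorable h ->
  factorable (fun x => g x * h x).
Proof.
move=> [dg [m [cm gm]]] [dh [n [cn hn]]]; split=> [x|].
  exact: differentiableM.
have cg := fun x => differentiable_continuous (dg x).
have ch := fun x => differentiable_continuous (dh x).
exists (fun k z => m k z * h z.2 + g z.1 * n k z); split=> [k x|x y].
  apply: cvgD; apply: cvgM; [exact: cm| |  |exact: cn].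
  - by apply: continuous_comp; [exact: cvg_snd|exact: ch].
  - by apply: continuous_comp; [exact: cvg_fst|exact: cg].
have -> : g y * h y - g x * h x = (g y - g x) * h y + g x * (h y - h x) by ring.
rewrite gm hn mulr_suml mulr_sumr -big_split/=.
by apply: eq_bigr => k _; ring.
Qed.

Lemma factorable_sum (I : Type) (r : seq I) (Q : pred I)
    (F : I -> 'rV[R]_d -> R) :
  (forall i, Q i -> factorable (F i)) ->
  factorable (fun x => \sum_(i <- r | Q i) F i x).
Proof.
move=> QF; elim: r => [|i r IHr].
  have -> : (fun x => \sum_(i <- [::] | Q i) F i x) = cst 0.
    by apply/funext => x; rewrite big_nil.
  exact: factorable_cst.
have -> : (fun x => \sum_(j <- i :: r | Q j) F j x) =
    if Q i then fun x => F i x + \sum_(j <- r | Q j) F j x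
    else fun x => \sum_(j <- r | Q j) F j x.
  by apply/funext => x; rewrite big_cons; case: (Q i).
by case: ifPn => // Qi; apply: factorableD => //; exact: QF.
Qed.

Lemma factorable_prod (I : Type) (r : seq I) (Q : pred I)
    (F : I -> 'rV[R]_d -> R) :
  (forall i, Q i -> factorable (F i)) ->
  factorable (fun x => \prod_(i <- r | Q i) F i x).
Proof.
move=> QF; elim: r => [|i r IHr].
  have -> : (fun x => \prod_(i <- [::] | Q i) F i x) = cst 1.
    by apply/funext => x; rewrite big_nil.
  exact: factorable_cst.
have -> : (fun x => \prod_(j <- i :: r | Q j) F j x) =
    if Q i then fun x => F i x * \prod_(j <- r | Q j) F j x
    else fun x => \prod_(j <- r | Q j) F j x.
  by apply/funext => x; rewrite big_cons; case: (Q i).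
by case: ifPn => // Qi; apply: factorableM => //; exact: QF.
Qed.

Lemma factorableX g n : factorable g -> factorable (fun x => g x ^+ n).
Proof.
move=> fg; elim: n => [|n IHn]; first exact: factorable_cst.
rewrite [X in factorable X](_ : _ = fun x => g x * g x ^+ n).
  exact: factorableM.
by apply/funext => x; rewrite exprS.
Qed.

Lemma poly_space_factorable s p g : poly_space s p g -> factorable g.
Proof.
move=> [c gE]; rewrite (funext gE); apply: factorable_sum => a _.
apply: factorableM; first exact: factorable_cst.
by apply: factorable_prod => i _; apply: factorableX; exact: factorable_coord.
Qed.

End factorable.

(** On the line [x + h e_i] the difference quotient is [m_i (x, x + h e_i)]. *)
Lemma hadamard_is_derive (R : realType) d (g : 'rV[R]_d -> R)
    (m : 'I_d -> 'rV[R]_d * 'rV[R]_d -> R) (x : 'rV[R]_d) (i : 'I_d) :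
  hadamard g m -> is_derive x (delta_mx 0 i) g (m i (x, x)).
Proof.
move=> [cm gm].
have lim : h^-1 * (g (h *: delta_mx 0 i + x) - g x) @[h --> 0^'] --> m i (x, x).
  have : m i (x, h *: delta_mx 0 i + x) @[h --> (0 : R)^'] --> m i (x, x).
    apply: (@cvg_comp _ _ _ (fun h => (x, h *: delta_mx 0 i + x)) (m i) _ (nbhs (x, x)));
      last exact: cm.
    by apply: (@cvg_pair _ _ _ _ (nbhs x) (nbhs x)); [exact: cvg_cst|exact: cvg_line].
  apply: cvg_trans; apply: near_eq_cvg; near=> h.
  rewrite gm (bigD1 i)//= !mxE !eqxx mulr1 addrK big1 ?addr0 => [|k ki].
    by rewrite mulKf//; near: h; exact: nbhs_dnbhs_neq.
  by rewrite !mxE eqxx/= (negbTE ki) mulr0 add0r subrr mul0r.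
split; last exact/cvg_lim.
by apply/cvg_ex; exists (m i (x, x)).
Unshelve. all: by end_near. Qed.

Lemma factorable_row_differentiable (R : realType) d
    (f : 'rV[R]_d -> 'rV[R]_d) (x : 'rV[R]_d) :
  (forall j, factorable (fun x => f x 0 j)) -> differentiable f x.
Proof.
move=> ff.
have -> : f = \sum_j (fun y => f y 0 j *: (delta_mx 0 j : 'rV[R]_d)).
  by apply/funext => y; rewrite fct_sumE -row_sum_delta.
by apply: differentiable_sum => j; apply: differentiableZl; exact: (ff j).1.
Qed.

Lemma jacobian_hadamard (R : realType) d (f : 'rV[R]_d -> 'rV[R]_d)
    (M : 'I_d -> 'I_d -> 'rV[R]_d * 'rV[R]_d -> R) (x : 'rV[R]_d) :
  (forall j, factorable (fun x => f x 0 j)) ->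
  (forall j, hadamard (fun x => f x 0 j) (M j)) ->
  jacobian f x = \matrix_(k, j) M j k (x, x).
Proof.
move=> ff fM; have df := factorable_row_differentiable x ff.
apply/matrixP => k j; rewrite [RHS]mxE.
have := deriveEjacobian (delta_mx 0 k) df.
rewrite -rowE => /rowP/(_ j); rewrite [X in _ = X -> _]mxE => <-.
rewrite derive_mx ?mxE; last exact: diff_derivable.
by have [_ ->] := hadamard_is_derive x k (fM j).
Qed.

(** * Partial derivatives of finite element functions *)

Lemma continuous_det (R : realType) (T : topologicalType) n (A : T -> 'M[R]_n) :
  (forall i j, continuous (fun z => A z i j)) -> continuous (fun z => \det (A z)).
Proof.
move=> cA z; apply: cvg_big => [|s _]; first exact: add_continuous.
apply: cvgM; first exact: cvg_cst.
by apply: cvg_big => [|i _]; [exact: mul_continuous|exact: cA].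
Qed.

Lemma continuous_adj (R : realType) (T : topologicalType) n (A : T -> 'M[R]_n) i j :
  (forall i j, continuous (fun z => A z i j)) ->
  continuous (fun z => (\adj (A z)) i j).
Proof.
move=> cA.
have -> : (fun z => (\adj (A z)) i j) =
    fun z => (-1) ^+ (j + i) * \det (row' j (col' i (A z))).
  by apply/funext => z; rewrite mxE.
move=> z; apply: cvgM; first exact: cvg_cst.
apply: (@continuous_det _ _ _ (fun z => row' j (col' i (A z)))) => k l.
have -> : (fun z => row' j (col' i (A z)) k l) = fun z => A z (lift j k) (lift i l).
  by apply/funext => {}z; rewrite !mxE.
exact: cA.
Qed.

(** The image of the part of [C] outside a neighbourhood of [psi y] is compact,
    hence closed, and misses [y] by injectivity. *)
Lemma continuous_compact_inverse (T U : topologicalType) (C : set T)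
    (f : T -> U) (psi : U -> T) (y : U) :
  hausdorff_space U -> compact C -> continuous f -> {in C &, injective f} ->
  (forall z, (f @` C) z -> C (psi z) /\ f (psi z) = z) ->
  (f @` C)° y -> {for y, continuous psi}.
Proof.
move=> hU cC cf injf psiP Cy A.
rewrite nbhsE => -[W [oW Wy] WA].
have [Cpsiy fpsiy] := psiP y (interior_subset Cy).
have clD : closed (f @` (C `&` ~` W)).
  apply: compact_closed => //; apply: continuous_compact.
    exact: continuous_subspaceT.
  by apply: compact_closedI => //; exact: open_closedC.
have nD : (~` (f @` (C `&` ~` W))) y.
  move=> [c [Cc Wc] fcy]; apply: Wc; suff -> : c = psi y by [].
  by apply: injf; rewrite ?inE// fcy fpsiy.
have := open_nbhs_nbhs (conj (closed_openC clD) nD).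
rewrite /nbhs/= => nD'.
near=> z; have [|Cz fz] := psiP z.
  near: z; exact: Cy.
apply: WA; apply: contrapT => Wz.
by apply: (near nD' z) => //; exists (psi z).
Unshelve. all: by end_near. Qed.

Lemma ref_cell_compact (R : realType) d s : compact (@ref_cell R d s).
Proof.
apply: bounded_closed_compact.
  exists 1; split=> // M M1 x sx.
  rewrite /= [leLHS]/Num.Def.normr/= mx_normrE.
  apply: bigmax_le => [|[i j] _]; first by apply: le_trans (ltW M1).
  rewrite ord1/=.
  apply: le_trans (ltW M1).
  case: s sx => /=; last by move=> /(_ j) /andP[x0 x1]; rewrite ger0_norm.
  move=> [x0 x1]; rewrite ger0_norm//; apply: le_trans x1.
  by rewrite (bigD1 j)//= lerDl sumr_ge0.
have c0 i : closed [set x : 'rV[R]_d | 0 <= x 0 i].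
  apply: (@closed_comp _ _ (fun x : 'rV[R]_d => x 0 i) [set r | 0 <= r]); last exact: closed_ge.
  by move=> x _; exact: coord_continuous.
have c1 i : closed [set x : 'rV[R]_d | x 0 i <= 1].
  apply: (@closed_comp _ _ (fun x : 'rV[R]_d => x 0 i) [set r | r <= 1]); last exact: closed_le.
  by move=> x _; exact: coord_continuous.
case: s.
  have -> : @ref_cell R d Simplex = \bigcap_i [set x : 'rV[R]_d | 0 <= x 0 i] `&`
      [set x | \sum_i x 0 i <= 1].
    by apply/seteqP; split=> x [xi xs]; split=> // i; [move=> _|]; exact: xi.
  apply: closedI; first by apply: closed_bigI => i _; exact: c0.
  apply: (@closed_comp _ _ (fun x : 'rV[R]_d => \sum_i x 0 i) [set r | r <= 1]);
    last exact: closed_le.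
  move=> x _; apply: continuous_big => [|i _]; first exact: add_continuous.
  exact: coord_continuous.
have -> : @ref_cell R d Box = \bigcap_i ([set x : 'rV[R]_d | 0 <= x 0 i] `&`
    [set x | x 0 i <= 1]).
  apply/seteqP; split=> x xi i; first by move=> _; split; have /andP[] := xi i.
  by apply/andP; exact: (xi i Logic.I).
by apply: closed_bigI => i _; apply: closedI; [exact: c0|exact: c1].
Qed.

(** The inverse [psi] of the geometry map is continuous at [x], and the increment
    [psi y - psi x] solves a linear system with matrix [J (psi x, psi y)], which
    is invertible for [y] close to [x]. So the difference quotients of [w] are
    continuous functions of [psi y]. *)
Lemma cell_partial (R : realType) d (K : cell R d) p (w g : 'rV[R]_d -> R) :
  regular_cell K -> poly_space (cshape K) p g ->
  (forall x, ref_cell (cshape K) x -> w (geo K x) = g x) ->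
  exists D : 'I_d -> 'rV[R]_d -> R, forall i,
    [/\ forall x, (body K)° x -> is_derive x (delta_mx 0 i) w (D i x),
        forall x, (body K)° x -> {for x, continuous (D i)} &
        [bounded D i x | x in (body K)°]].
Proof.
move=> rK gp wg; set C := ref_cell (cshape K) in wg *.
have fgeo j : factorable (fun x => geo K x 0 j).
  exact: poly_space_factorable (geo_poly rK j).
have [M HM] := choice (fun j => (fgeo j).2).
have [fg [m [cm gm]]] := poly_space_factorable gp.
have cgeo : continuous (geo K).
  by move=> x; exact/differentiable_continuous/factorable_row_differentiable.
pose J z : 'M[R]_d := \matrix_(k, j) M j k z.
have cJ k j : continuous (fun z => J z k j).
  have -> : (fun z => J z k j) = M j k by apply/funext => z; rewrite mxE.
  exact: (HM j).1.
have detJ x : C x -> \det (J (x, x)) != 0.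
  move=> Cx; rewrite -unitfE -unitmxE.
  have <- : jacobian (geo K) x = J (x, x) by exact: jacobian_hadamard.
  exact: geo_jac.
(* At a diagonal point, [Q i] is the [i]-th entry of [J^-1 grad g]. *)
pose Q i z := (\sum_k (\adj (J z)) i k * m k z) / \det (J z).
(* Cramer's rule for [(b - a) J = h e_i] in the factorization of [g]. *)
have key i h a b : geo K b = h *: delta_mx 0 i + geo K a ->
    \det (J (a, b)) != 0 -> g b - g a = h * Q i (a, b).
  move=> gab det0.
  have bJ : (b - a) *m J (a, b) = h *: delta_mx 0 i.
    apply/rowP => j; rewrite mxE.
    transitivity (geo K b 0 j - geo K a 0 j); last by rewrite gab !mxE addrK.
    by rewrite (HM j).2; apply: eq_bigr => k _; rewrite !mxE.
  have ba : \det (J (a, b)) *: (b - a) = h *: row i (\adj (J (a, b))).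
    by rewrite -mul_mx_scalar -mul_mx_adj mulmxA bJ -scalemxAl -rowE.
  apply: (mulIf det0); rewrite gm /Q -!mulrA mulVf// mulr1 mulr_suml mulr_sumr.
  move: (\adj _) ba => A ba; apply: eq_bigr => k _.
  have /rowP/(_ k) := ba; rewrite !mxE => bak.
  by rewrite mulrAC [_ * \det _]mulrC bak mulrA.
have cQ i x : C x -> {for (x, x), continuous (Q i)}.
  move=> Cx; apply: cvgM; last first.
    by apply: cvgV; [exact: detJ|exact: continuous_det].
  apply: cvg_big => [|k _]; first exact: add_continuous.
  by apply: cvgM; [exact: continuous_adj|exact: cm].
have [psi psiP] : exists psi : 'rV[R]_d -> 'rV[R]_d,
    forall y, body K y -> C (psi y) /\ geo K (psi y) = y.
  have /choice[psi psiP] : forall y, exists x, body K y -> C x /\ geo K x = y.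
    move=> y; have [[x Cx xy]|nKy] := pselect (body K y); first by exists x.
    by exists 0.
  by exists psi.
have cpsi y : (body K)° y -> {for y, continuous psi}.
  apply: (@continuous_compact_inverse _ _ C (geo K)) => //.
  - exact: ref_cell_compact.
  - exact: geo_inj.
have int_body y : (body K)° y -> body K y by exact: interior_subset.
exists (fun i x => Q i (psi x, psi x)) => i; split.
- move=> x Kx; have [Cx gx] := psiP x (int_body _ Kx).
  have lim : h^-1 * (w (h *: delta_mx 0 i + x) - w x) @[h --> 0^'] -->
      Q i (psi x, psi x).
    have lim' : (psi x, psi (h *: delta_mx 0 i + x)) @[h --> (0 : R)^'] --> (psi x, psi x).
      apply: (@cvg_pair _ _ _ _ (nbhs (psi x)) (nbhs (psi x))); first exact: cvg_cst.
      exact: (cvg_comp _ _ (@cvg_line _ _ x (delta_mx 0 i)) (cpsi _ Kx)).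
    have detn : \forall h \near (0 : R)^',
        \det (J (psi x, psi (h *: delta_mx 0 i + x))) != 0.
      apply: cvgr_neq0 (detJ _ Cx).
      apply: (@cvg_comp _ _ _ (fun h => (psi x, psi (h *: delta_mx 0 i + x)))
        (fun z => \det (J z)) _ _ _ lim').
      exact: continuous_det.
    have := cvg_comp _ _ lim' (cQ i _ Cx).
    apply: cvg_trans; apply: near_eq_cvg; near=> h.
    have [|Ch gh] := psiP (h *: delta_mx 0 i + x).
      by near: h; exact: (@cvg_line _ _ x (delta_mx 0 i) _ Kx).
    have h0 : h != 0 by near: h; exact: nbhs_dnbhs_neq.
    have := wg _ Ch; rewrite gh => ->.
    have := wg _ Cx; rewrite gx => ->.
    rewrite (key i h) ?mulKf// ?gh ?gx//.
    by near: h; exact: detn.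
  split; last exact/cvg_lim.
  by apply/cvg_ex; exists (Q i (psi x, psi x)).
- move=> x Kx; have [Cx gx] := psiP x (int_body _ Kx).
  apply: (@cvg_comp _ _ _ (fun x => (psi x, psi x)) (Q i) _ (nbhs (psi x, psi x)));
    last exact: cQ.
  have cx : psi y @[y --> x] --> psi x by exact: (cpsi _ Kx).
  by apply: (@cvg_pair _ _ _ _ (nbhs (psi x)) (nbhs (psi x))) => //; exact: nbhs_filter.
- have : compact ((fun c => Q i (c, c)) @` C).
    apply: continuous_compact; last exact: ref_cell_compact.
    apply: continuous_in_subspaceT => c /set_mem Cc.
    apply: (@cvg_comp _ _ _ (fun x => (x, x)) (Q i) _ (nbhs (c, c))); last exact: cQ.
    by apply: (@cvg_pair _ _ _ _ (nbhs c) (nbhs c)) => //; exact: nbhs_filter.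
  move=> /compact_bounded[B [Br QB]]; exists B; split=> // B' BB' x Kx.
  by apply: QB BB' _ _; exists (psi x) => //; have [] := psiP x (int_body _ Kx).
Unshelve. all: by end_near. Qed.

(** * Bounded measurable functions *)

(** On [G], the superlevel sets of [v] are the traces of intervals. *)
Lemma measurable_fun_nondecreasing_on (R : realType) dT (T : measurableType dT)
    (D : set T) (G : set R) (v : R -> R) (h : T -> R) :
  {in G &, {homo v : a b / a <= b}} -> (forall x, D x -> G (h x)) ->
  measurable_fun D h -> measurable_fun D (fun x => v (h x)).
Proof.
move=> vG hG mh mD; apply: (measurability _ (RGenOInfty.measurableE R)) => //.
move=> /= _ [_ [r ->] <-].
pose I := [set b | exists c, [/\ G c, c <= b & r < v c]].
rewrite (_ : _ `&` _ = D `&` h @^-1` I).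
  apply: mh => //; apply: is_interval_measurable => a b [c [Gc ca rc]] _ z /andP[az _].
  by exists c; split=> //; exact: le_trans az.
apply/seteqP; split=> x /= [Dx]; rewrite in_itv/= andbT.
  by move=> rv; split=> //; exists (h x); split=> //; exact: hG.
move=> [c [Gc ch rc]]; split=> //; apply: lt_le_trans rc _.
by apply: vG; rewrite ?inE//; exact: hG.
Qed.

(** The integrands here are products of factors that are continuous on [U] and a
    monotone function of a continuous one: boundedness, unlike integrability, is
    stable under products. *)
Definition bounded_measurable (R : realType) d (U : set 'rV[R]_d)
    (g : 'rV[R]_d -> R) : Prop :=
  measurable_fun (@pt R d @^-1` U) (g \o @pt R d) /\
  exists B, forall x, U x -> `|g x| <= B.

Section bounded_measurable.
Context {R : realType} {d : nat} (U : set 'rV[R]_d).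
Implicit Types g h : 'rV[R]_d -> R.

Lemma eq_bounded_measurable g h : (forall x, U x -> g x = h x) ->
  bounded_measurable U g -> bounded_measurable U h.
Proof.
move=> gh [mg [B gB]]; split.
  by apply: eq_measurable_fun mg => x /set_mem/gh.
by exists B => x Ux; rewrite -gh//; exact: gB.
Qed.

Lemma bounded_measurable_cst (c : R) : bounded_measurable U (cst c).
Proof. by split; [exact: measurable_cst|exists `|c|]. Qed.

Lemma bounded_measurableD g h :
  bounded_measurable U g -> bounded_measurable U h ->
  bounded_measurable U (fun x => g x + h x).
Proof.
move=> [mg [B gB]] [mh [C hC]]; split; first exact: measurable_funD.
exists (B + C) => x Ux.
by apply: le_trans (ler_normD _ _) _; rewrite lerD ?gB ?hC.
Qed.

Lemma bounded_measurableM g h :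
  bounded_measurable U g -> bounded_measurable U h ->
  bounded_measurable U (fun x => g x * h x).
Proof.
move=> [mg [B gB]] [mh [C hC]]; split; first exact: measurable_funM.
by exists (B * C) => x Ux; rewrite normrM ler_pM ?gB ?hC.
Qed.

Lemma bounded_measurable_sum (I : Type) (r : seq I) (F : I -> 'rV[R]_d -> R) :
  (forall i, bounded_measurable U (F i)) ->
  bounded_measurable U (fun x => \sum_(i <- r) F i x).
Proof.
move=> tF; elim: r => [|i r IHr].
  by apply: eq_bounded_measurable (bounded_measurable_cst 0) => x _; rewrite big_nil.
by apply: eq_bounded_measurable (bounded_measurableD (tF i) IHr) => x _; rewrite big_cons.
Qed.

Lemma bounded_measurable_continuous g (C : set 'rV[R]_d) :
  open U -> compact C -> U `<=` C ->
  continuous g -> bounded_measurable U g.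
Proof.
move=> oU cC UC cg; split.
  by apply: measurable_fun_pt => // x _; exact: cg.
have : compact (g @` C) by apply: continuous_compact => //; exact: continuous_subspaceT.
move=> /compact_bounded[B [Br gB]]; exists (B + 1) => x Ux.
by apply: gB; [rewrite ltrDl|exists x => //; exact: UC].
Qed.

Lemma bounded_measurable_integrable g :
  open U -> bounded_set U -> bounded_measurable U g ->
  (@leb R d).-integrable (@pt R d @^-1` U) (EFin \o (g \o @pt R d)).
Proof.
move=> oU bU [mg [B gB]]; apply: integrable_pt => //.
exists B; split=> [|B' BB' x Ux]; first exact: num_real.
by apply: le_trans (ltW BB'); exact: gB.
Qed.

End bounded_measurable.

Lemma integral_rVD (R : realType) d (U : set 'rV[R]_d) g h :
  open U -> bounded_set U -> bounded_measurable U g -> bounded_measurable U h ->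
  integral_rV U (fun x => g x + h x) = integral_rV U g + integral_rV U h.
Proof.
move=> oU bU tg th; rewrite /integral_rV RintegralD//.
- exact: measurable_preimage_pt.
- exact: (bounded_measurable_integrable oU bU tg).
- exact: (bounded_measurable_integrable oU bU th).
Qed.

(** * Stability of the finite element space *)

Lemma poly_space_lincomb (R : realType) d s p N (c : 'I_N -> R)
    (g : 'I_N -> 'rV[R]_d -> R) :
  (forall j, poly_space s p (g j)) -> poly_space s p (fun x => \sum_j c j * g j x).
Proof.
move=> /choice[b gb]; exists (fun a => \sum_j c j * b j a) => x.
under eq_bigr do rewrite gb mulr_sumr.
rewrite exchange_big/=; apply: eq_bigr => a _.
by rewrite mulr_suml; apply: eq_bigr => j _; rewrite mulrA.
Qed.

Lemma fe_fun_in_space (R : realType) d (P : 'M[R]_d) nE (K : 'I_nE -> cell R d)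
    p N (phi : 'I_N -> 'rV[R]_d -> R) (c : 'I_N -> R) :
  (forall j, fe_space P K p (phi j)) -> fe_space P K p (fe_fun phi c).
Proof.
move=> phiV; split.
- by move=> x z Pz; apply: eq_bigr => j _; rewrite (fe_periodic (phiV j)).
- apply: continuous_big => [|j _ x]; first exact: add_continuous.
  by apply: (@continuousM _ _ (cst (c j)) (phi j));
    [exact: cst_continuous|exact: (fe_continuous (phiV j))].
- move=> e.
  have /choice[g gP] : forall j, exists g, poly_space (cshape (K e)) p g /\
      forall x, ref_cell (cshape (K e)) x -> phi j (geo (K e) x) = g x.
    by move=> j; have [g gp gE] := fe_local (phiV j) e; exists g.
  exists (fun x => \sum_j c j * g j x).
    by apply: poly_space_lincomb => j; exact: (gP j).1.
  by move=> x Cx; apply: eq_bigr => j _; rewrite (gP j).2.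
Qed.

(** * The entropy balance on a cell *)

Lemma body_compact (R : realType) d (K : cell R d) :
  regular_cell K -> compact (body K).
Proof.
move=> rK; apply: continuous_compact; last exact: ref_cell_compact.
apply: continuous_subspaceT => x; apply: differentiable_continuous.
apply: factorable_row_differentiable => j.
exact: poly_space_factorable (geo_poly rK j).
Qed.

Lemma continuous_within_comp (R : realType) (T : topologicalType) (G : set R)
    (g : R -> R) (h : T -> R) :
  {within G, continuous g} -> (forall x, G (h x)) -> continuous h ->
  continuous (fun x => g (h x)).
Proof.
move=> /subspace_continuousP cg hG ch x A /(cg _ (hG x)) gA.
apply: (@filterS _ (nbhs x) _ (h @^-1` [set z | G z -> A (g z)])); last exact: (ch x).
by move=> y; apply; exact: hG.
Qed.

Section entropy_balance.
Context {R : realType} {d : nat} (G : set R) (f f' : 'I_d -> R -> R)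
  (eta v : R -> R) (q : 'I_d -> R -> R) (P : 'M[R]_d) (nE : nat)
  (K : 'I_nE -> cell R d) (p N : nat) (phi : 'I_N -> 'rV[R]_d -> R)
  (u : 'I_N -> R -> R).
Hypothesis G_convex : convex_set (G : set (convex_lmodType R^o)).
Hypothesis f_deriv : forall i a, G a -> has_deriv_in G (f i) a (f' i a).
Hypothesis f'_cont : forall i, {within G, continuous (f' i)}.
Hypothesis eta_q : entropy_pair G f' eta v q.
Hypothesis K_regular : forall e, regular_cell (K e).
Hypothesis phiV : forall j, fe_space P K p (phi j).
Hypothesis u_deriv : forall j t, 0 < t -> derivable (u j) t 1.
Let uh t := fe_fun phi (fun j => u j t).
Hypothesis uh_G : forall t x, 0 < t -> G (uh t x).

(** Both balances have the same shape, with outer derivatives [1] and [f'] in one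
    case and [v] and [v f'] in the other; [balE] treats them together. *)
Lemma balance_chain_rule e t : 0 < t ->
  bounded_measurable (body (K e))° (balance id f uh t) /\
  forall x, (body (K e))° x ->
    balance eta q uh t x = v (uh t x) * balance id f uh t x.
Proof.
move=> t0; have uhV s := fe_fun_in_space (fun j => u j s) phiV.
have cuh : continuous (uh t) := fe_continuous (uhV t).
have [g gp gE] := fe_local (uhV t) e.
have [D DP] := cell_partial (K_regular e) gp gE.
pose dt x := \sum_j 'D_1 (u j) t * phi j x.
have uh_dt x : is_derive t 1 (fun s => uh s x) (dt x).
  have -> : (fun s => uh s x) = \sum_j (phi j x *: u j).
    by apply/funext => s; rewrite fct_sumE; apply: eq_bigr => j _; rewrite mulrC.
  have -> : dt x = \sum_j phi j x *: 'D_1 (u j) t.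
    by apply: eq_bigr => j _; rewrite mulrC.
  by apply: is_derive_sum => j; apply: is_deriveZ; exact/derivableP/u_deriv.
have Gnear x : \forall s \near t, G (uh s x).
  by near=> s; apply: uh_G; near: s; exact: lt_nbhsr.
have balE (g1 l : R -> R) (g2 m : 'I_d -> R -> R) x :
    (forall a, G a -> has_deriv_in G g1 a (l a)) ->
    (forall i a, G a -> has_deriv_in G (g2 i) a (m i a)) ->
    (body (K e))° x ->
    balance g1 g2 uh t x = l (uh t x) * dt x + \sum_i m i (uh t x) * D i x.
  move=> g1l g2m Kx; rewrite /balance derive1E; congr (_ + _).
    by have [_ ->] := @is_derive_comp_within _ _ G g1 _ (fun s => uh s x) t 1 _
      (g1l _ (uh_G x t0)) (Gnear x) (uh_dt x).
  apply: eq_bigr => i _; have [/(_ x Kx) Dx _ _] := DP i.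
  have Gx : \forall y \near x, G (uh t y) by near=> y; exact: uh_G.
  by have [_ ->] := @is_derive_comp_within _ _ G (g2 i) _ (uh t) x _ _
    (g2m i _ (uh_G x t0)) Gx Dx.
have id_deriv a : G a -> has_deriv_in G id a 1.
  move=> _; have one : 1 @[y --> within G a^'] --> (1 : R) by exact: cvg_cst.
  apply: cvg_trans one; apply: near_eq_cvg; rewrite near_withinE; near=> y => _.
  by rewrite divff// subr_eq0; near: y; exact: nbhs_dnbhs_neq.
have balid x : (body (K e))° x ->
    dt x + \sum_i f' i (uh t x) * D i x = balance id f uh t x.
  by move=> Kx; rewrite (balE id (cst 1) f f')// mul1r.
split=> [|x Kx].
  apply: eq_bounded_measurable balid _; have oK : open (body (K e))° by exact: open_interior.
  have KK := @interior_subset _ (body (K e)).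
  have cK := body_compact (K_regular e).
  apply: bounded_measurableD.
    apply: (bounded_measurable_continuous oK cK KK).
    exact: (fe_continuous (fe_fun_in_space _ phiV)).
  apply: bounded_measurable_sum => i; apply: bounded_measurableM.
    apply: (bounded_measurable_continuous oK cK KK).
    apply: continuous_within_comp => // x; exact: uh_G.
  have [_ cD [B [Br DB]]] := DP i; split; first exact: measurable_fun_pt.
  by exists (B + 1) => x Kx; apply: DB => //; rewrite ltrDl.
rewrite -balid// (balE eta v q (fun i a => v a * f' i a))//.
- rewrite mulrDr mulr_sumr; congr (_ + _).
  by apply: eq_bigr => i _; rewrite mulrA.
- exact: entropy_variable eta_q.
- exact: entropy_flux eta_q.
Unshelve. all: by end_near. Qed.

(** By monotonicity, the bounds on a cell are the values of [v] at a minimum and at a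
    maximum of [u_h]: these are points of [G], whereas [v] may be unbounded near an
    end point of [G] that is missing from [G]. *)
Lemma bounded_measurable_entropy_variable e t : 0 < t ->
  bounded_measurable (body (K e))° (fun x => v (uh t x)).
Proof.
move=> t0; have cuh : continuous (uh t).
  exact: fe_continuous (fe_fun_in_space _ phiV).
have v_homo : {in G &, {homo v : a b / a <= b}}.
  exact: convex_derive_nondecreasing G_convex (entropy_convex eta_q)
    (entropy_variable eta_q).
have oK : open (body (K e))° by exact: open_interior.
split.
  apply: measurable_fun_nondecreasing_on v_homo _ _ => [x _|]; first exact: uh_G.
  by apply: measurable_fun_pt => // x _; exact: cuh.
have [->|/set0P[x0 Kx0]] := eqVneq (body (K e)) set0.
  by exists 0 => x; rewrite interior0.
have [cmin _ minP] : exists2 c, c \in body (K e) &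
    forall x, x \in body (K e) -> uh t c <= uh t x.
  apply: EVT_min_rV; [by exists x0|exact: body_compact|exact: continuous_subspaceT].
have [cmax _ maxP] : exists2 c, c \in body (K e) &
    forall x, x \in body (K e) -> uh t x <= uh t c.
  apply: EVT_max_rV; [by exists x0|exact: body_compact|exact: continuous_subspaceT].
exists (`|v (uh t cmin)| + `|v (uh t cmax)|) => x /interior_subset/mem_set Kx.
have vmin : v (uh t cmin) <= v (uh t x).
  by apply: v_homo; [exact/mem_set/uh_G|exact/mem_set/uh_G|exact: minP].
have vmax : v (uh t x) <= v (uh t cmax).
  by apply: v_homo; [exact/mem_set/uh_G|exact/mem_set/uh_G|exact: maxP].
have := ler_norm (v (uh t cmax)); have := ler_norm (- v (uh t cmin)).
rewrite normrN ler_norml => h1 h2.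
have := normr_ge0 (v (uh t cmin)); have := normr_ge0 (v (uh t cmax)).
by move=> h3 h4; apply/andP; split; lra.
Qed.

End entropy_balance.

(** * The entropy inequality *)

(** If [b = 0] and [a > 0], then [a / 0 = +oo] exceeds every [nu]. *)
Lemma le_of_quotient_bound (R : realType) (a b nu : R) :
  0 <= b -> ((Num.max 0 a)%:E / b%:E <= nu%:E)%E -> a <= nu * b.
Proof.
rewrite le_eqVlt => /predU1P[<-|b0].
  have [a0|a0] := leP a 0; first by rewrite mulr0.
  by rewrite inver eqxx gt0_muley ?lte_fin// leye_eq.
rewrite inver gt_eqF// -EFinM lee_fin ler_pdivrMr//.
by apply: le_trans; rewrite le_max lexx orbT.
Qed.

Theorem theorem2 (R : realType) (d : nat) (d_le3 : (1 <= d <= 3)%N)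
  (* invariant set, flux, entropy pair *)
  (G : set R) (G_convex : convex_set (G : set (convex_lmodType R^o)))
  (f f' : 'I_d -> R -> R)
  (f_deriv : forall i a, G a -> has_deriv_in G (f i) a (f' i a))
  (f'_cont : forall i, {within G, continuous (f' i)})
  (eta v : R -> R) (q : 'I_d -> R -> R)
  (eta_q : entropy_pair G f' eta v q)
  (* mesh, space, nodes, basis, submeshes *)
  (P : 'M[R]_d) (Om : set 'rV[R]_d) (nE : nat) (K : 'I_nE -> cell R d)
  (K_mesh : periodic_mesh P Om K)
  (p : nat) (p_gt0 : (0 < p)%N)
  (N : nat) (xn : 'I_N -> 'rV[R]_d) (phi : 'I_N -> 'rV[R]_d -> R)
  (xn_dom : forall j, closure Om (xn j))
  (phi_basis : is_basis (fe_space P K p) phi)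
  (phi_nodal : lagrange_basis xn phi \/ bernstein_basis P K p xn phi)
  (nS : 'I_nE -> nat) (Sm : forall e, 'I_(nS e) -> cell R d)
  (Sm_submesh : forall e, is_submesh (K e) (cell_nodes P xn (K e)) (@Sm e))
  (* approximate solution *)
  (u : 'I_N -> R -> R)
  (u_deriv : forall j t, 0 < t -> derivable (u j) t 1)
  (uh := fun t => fe_fun phi (fun j => u j t))
  (uh_G : forall t x, 0 < t -> G (uh t x))
  (* approximate entropy variable *)
  (vc : 'I_N -> R -> R)
  (vh := fun t => fe_fun phi (fun j => vc j t))
  (vh_approx :
     (forall t, 0 < t -> forall j, vc j t = v (u j t)) \/
     (forall t, 0 < t ->
        is_L2_projection (fe_space P K p) K (fun x => v (uh t x)) (vh t)))
  (* linear stabilization *)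
  (sLS : 'I_nE -> ('rV[R]_d -> R) -> (R -> 'rV[R]_d -> R) -> R -> R)
  (sLS_linear : forall e t (a : R) w1 w2, 0 < t ->
     fe_space P K p w1 -> fe_space P K p w2 ->
     sLS e (fun x => a * w1 x + w2 x) uh t = a * sLS e w1 uh t + sLS e w2 uh t)
  (* entropy viscosity *)
  (nu : 'I_nE -> R -> R)
  (nu_ge0 : forall e t, 0 < t -> 0 <= nu e t)
  (nu_ge_min : forall e t, 0 < t ->
     (nu_min (K e) (@Sm e) f v (sLS e) vh uh t <= (nu e t)%:E)%E)
  (scheme : forall t, 0 < t -> forall w, fe_space P K p w ->
     \sum_e (cell_integral (K e) (fun x => w x * balance id f uh t x)
             + sLS e w uh t
             + sEV (K e) (@Sm e) (nu e t) w (vh t)) = 0) :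
  forall t, 0 < t ->
    \sum_e cell_integral (K e) (fun x => balance eta q uh t x) <= 0.
Proof.
move=> t t0; have K_regular := mesh_regular K_mesh.
have phiV := basis_in phi_basis.
have vhV : fe_space P K p (vh t) := fe_fun_in_space _ phiV.
pose U e := (body (K e))°.
have oU e : open (U e) by exact: open_interior.
have bU e : bounded_set (U e).
  have := compact_bounded (body_compact (K_regular e)) => -[B [Br KB]].
  by exists B; split=> // B' BB' x /interior_subset; exact: KB.
pose bal := balance id f uh t; pose veh x := v (uh t x).
have tbal e : bounded_measurable (U e) bal.
  exact: (balance_chain_rule f_deriv f'_cont eta_q K_regular phiV u_deriv uh_G e t0).1.
have tveh e : bounded_measurable (U e) veh.
  exact: (bounded_measurable_entropy_variable G_convex eta_q K_regular phiV uh_G e t0).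
have tvh e : bounded_measurable (U e) (vh t).
  apply: (bounded_measurable_continuous (oU e) (body_compact (K_regular e))).
    exact: interior_subset.
  exact: fe_continuous vhV.
pose fl2 e := cell_integral (K e) (fun x => fluct (@Sm e) (vh t) x ^+ 2).
have fl2_ge0 e : 0 <= fl2 e by apply: Rintegral_ge0 => x _; exact: sqr_ge0.
have etaE e : cell_integral (K e) (balance eta q uh t) =
    entropy_production (K e) f v (sLS e) vh uh t + sLS e (vh t) uh t +
    cell_integral (K e) (fun x => vh t x * bal x).
  rewrite /entropy_production subrK /cell_integral -(integral_rVD (oU e) (bU e)).
  - apply: eq_Rintegral => x /set_mem Ux.
    have [_ ->//] := balance_chain_rule f_deriv f'_cont eta_q K_regular phiV u_deriv uh_G e t0.
    by rewrite -mulrDl subrK.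
  - apply: bounded_measurableM => //.
    apply: (@eq_bounded_measurable _ _ _ (fun x => veh x + (- 1) * vh t x)).
      by move=> x _; rewrite mulN1r.
    apply: bounded_measurableD => //; apply: bounded_measurableM => //.
    exact: (bounded_measurable_cst _ (- 1)).
  - exact: (bounded_measurableM (tvh e) (tbal e)).
have prod_le e : entropy_production (K e) f v (sLS e) vh uh t <= nu e t * fl2 e.
  apply: le_of_quotient_bound => //; exact: nu_ge_min.
rewrite (eq_bigr _ (fun e _ => etaE e)) -[leRHS](scheme t t0 _ vhV).
apply: ler_sum => e _; rewrite /sEV -/bal.
have -> : cell_integral (K e)
    (fun x => fluct (@Sm e) (vh t) x * fluct (@Sm e) (vh t) x) = fl2 e.
  by congr cell_integral; apply/funext => x; rewrite expr2.
by have := prod_le e; lra.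
Qed.
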